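(* Let $X$ be a Dedekind complete Banach lattice and let $\{P_\lambda\}_{\lambda\in\Lambda}$ be a family of pairwise disjoint band projections on $X$. Let $\Gamma\subseteq\Lambda\times\Lambda$ be any subset. Then the map $$\mathcal{P}_\Gamma\colon \mathcal{L}_+(X)\longrightarrow\mathcal{L}_+(X),\qquad T\longmapsto \bigvee_{(\alpha,\beta)\in\Gamma}P_\alpha T P_\beta$$ (supremum taken in $\mathcal{L}_r(X)$) extends to a unique band projection $\mathcal{P}_\Gamma\colon\mathcal{L}_r(X)\to\mathcal{L}_r(X)$.
   Context: Banach lattices are real. $\mathcal{L}(X)$ denotes the bounded linear operators on $X$, ordered by $S\le T$ iff $Sx\le Tx$ for all $x\in X_+$; $\mathcal{L}_+(X)$ is the set of positive operators and $\mathcal{L}_r(X)$ its linear span (the regular operators). For $X$ Dedekind complete, $\mathcal{L}_r(X)$ with the regular norm is a (Dedekind complete) Banach lattice. A band projection on a Banach lattice $Y$ is a linear map $P\colon Y\to Y$ with $P^2=P$ and $0\le P\le I_Y$ (equivalently, the positive projection onto a projection band $B$ vanishing on $B^{\perp}$). Band projections $P_\lambda$ are pairwise disjoint if $P_\lambda P_\mu=0$ for $\lambda\ne\mu$, equivalently their ranges are pairwise disjoint bands. An empty supremum of positive operators is $0$. *)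

(* Defs.v *)
From HB Require Import structures.
From mathcomp Require Import all_boot all_order all_algebra.
From mathcomp Require Import all_classical all_reals all_analysis.

Set Implicit Arguments.
Unset Strict Implicit.
Unset Printing Implicit Defensive.

Import Order.TTheory GRing.Theory Num.Theory.
Import numFieldNormedType.Exports.

Local Open Scope classical_set_scope.
Local Open Scope ring_scope.

HB.mixin Record isOrderedLmodule (R : numDomainType) V
    of Num.POrderedZmodule V & GRing.Lmodule R V := {
  leoD2l : forall z x y : V, x <= y -> z + x <= z + y;
  scaleo_ge0 : forall (a : R) (x : V), 0 <= a -> 0 <= x -> 0 <= a *: x
}.

#[short(type="orderedLmodType")]
HB.structure Definition OrderedLmodule (R : numDomainType) :=
  { V of isOrderedLmodule R V & Num.POrderedZmodule V & GRing.Lmodule R V }.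

(* A record over completeNormedModType rather than a structure of the
   hierarchy: the hierarchy has no join of a norm and an order below
   numDomainType. The instances declared below make the library's order,
   lattice and norm notations available on the carrier. *)
Record banachLattice (R : realType) := BanachLattice {
  bl_space : completeNormedModType R;
  bl_le : rel bl_space;
  bl_meet : bl_space -> bl_space -> bl_space;
  bl_join : bl_space -> bl_space -> bl_space;
  bl_le_refl : reflexive bl_le;
  bl_le_anti : antisymmetric bl_le;
  bl_le_trans : transitive bl_le;
  bl_meetP : forall x y z, bl_le x (bl_meet y z) = bl_le x y && bl_le x z;
  bl_joinP : forall x y z, bl_le (bl_join x y) z = bl_le x z && bl_le y z;
  bl_leD2l : forall z x y, bl_le x y -> bl_le (z + x) (z + y);
  bl_scale_ge0 : forall (a : R) x, 0 <= a -> bl_le 0 x -> bl_le 0 (a *: x);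
  bl_le_norm : forall x y,
    bl_le (bl_join x (- x)) (bl_join y (- y)) -> `|x| <= `|y|
}.

Definition bl_car (R : realType) (X : banachLattice R) : Type := bl_space X.
Coercion bl_car : banachLattice >-> Sortclass.

HB.instance Definition _ (R : realType) (X : banachLattice R) :=
  CompleteNormedModule.copy (bl_car X) (bl_space X).
HB.instance Definition _ (R : realType) (X : banachLattice R) :=
  Order.Le_isPOrder.Build ring_display (bl_car X)
    (@bl_le_refl R X) (@bl_le_anti R X) (@bl_le_trans R X).
HB.instance Definition _ (R : realType) (X : banachLattice R) :=
  Order.POrder_MeetJoin_isLattice.Build ring_display (bl_car X)
    (@bl_meetP R X) (@bl_joinP R X).
HB.instance Definition _ (R : realType) (X : banachLattice R) :=
  isOrderedLmodule.Build R (bl_car X) (@bl_leD2l R X) (@bl_scale_ge0 R X).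

Definition dedekind_complete (d : Order.disp_t) (V : porderType d) :=
  forall A : set V, has_sup A -> supremums A !=set0.

Definition band_projection (R : numDomainType) (Y : orderedLmodType R)
    (P : Y -> Y) :=
  [/\ linear P, forall x, P (P x) = P x & forall x, 0 <= x -> 0 <= P x <= x].

Definition linear_span (R : pzRingType) (V : lmodType R) (A : set V) : set V :=
  [set v | forall W : set V,
     W 0 -> (forall (a : R) u w, W u -> W w -> W (a *: u + w)) ->
     A `<=` W -> W v].

Section OrderedLmoduleTheory.
Context (R : numDomainType) (V : orderedLmodType R).
Implicit Types x y : V.

Lemma leo_subr_ge0 x y : (0 <= y - x) = (x <= y).
Proof.
apply/idP/idP => h; last by have := leoD2l (- x) _ _ h; rewrite addNr addrC.
by have := leoD2l x _ _ h; rewrite addr0 addrC subrK.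
Qed.

Lemma leo_addr_ge0 x y : 0 <= x -> 0 <= y -> 0 <= x + y.
Proof.
by move=> x0 y0; apply: (le_trans x0); have := leoD2l x _ _ y0; rewrite addr0.
Qed.

Lemma leoN2 x y : (- x <= - y) = (y <= x).
Proof. by rewrite -(leo_subr_ge0 (- x)) opprK addrC leo_subr_ge0. Qed.

End OrderedLmoduleTheory.

Section BanachLatticeTheory.
Context (R : realType) (X : banachLattice R).
Implicit Types x y : X.

Definition labs x : X := (x `|` - x)%O.

Lemma ler_labs_norm x y : labs x <= labs y -> `|x| <= `|y|.
Proof. exact: bl_le_norm. Qed.

Lemma labs_le x y : - y <= x -> x <= y -> labs x <= y.
Proof. by move=> yx xy; rewrite /labs leUx xy -leoN2 opprK. Qed.

Lemma ler_labs x : x <= labs x. Proof. exact: leUl. Qed.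

Lemma lerN_labs x : - x <= labs x. Proof. exact: leUr. Qed.

Lemma labs_ge0 x : 0 <= labs x.
Proof.
have : 0 <= labs x + labs x.
  rewrite -(subrr x); apply: (@le_trans _ _ (x + labs x)).
    exact/leoD2l/lerN_labs.
  by rewrite ![_ + labs x]addrC; exact/leoD2l/ler_labs.
have h2 : (0 : R) <= 2^-1 by rewrite invr_ge0.
move=> /(scaleo_ge0 _ _ h2).
by rewrite -(mulr2n (labs x)) -(scaler_nat 2 (labs x)) scalerA mulVf ?scale1r// pnatr_eq0.
Qed.

Lemma labs_id x : labs (labs x) = labs x.
Proof.
apply/le_anti/andP; split; last exact: ler_labs.
apply: labs_le => //; apply: (@le_trans _ _ 0); last exact: labs_ge0.
by rewrite -oppr0 leoN2 labs_ge0.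
Qed.

Lemma labs_norm x : `|labs x| = `|x|.
Proof. by apply/le_anti/andP; split; apply: ler_labs_norm; rewrite labs_id. Qed.

End BanachLatticeTheory.

Section BoundedOperators.
Context (R : realType) (X : banachLattice R).

Definition bounded_operator : {pred X -> X} :=
  mem [set f : X -> X | linear f /\ bounded_near f (nbhs (0 : X))].

Lemma bounded_operatorP (f : X -> X) : f \in bounded_operator <->
  linear f /\ exists M, forall x, `|f x| <= M * `|x|.
Proof.
split.
  rewrite inE => -[lf bf]; split => //.
  pose g : {linear X -> X} := HB.pack f (GRing.isLinear.Build R X X *:%R f lf).
  have /linear_boundedP [M [_ hM]] : bounded_near g (nbhs (0 : X)) by [].
  by exists (M + 1); apply: hM; rewrite ltrDl.
move=> [lf [M hM]]; rewrite inE; split => //.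
pose g : {linear X -> X} := HB.pack f (GRing.isLinear.Build R X X *:%R f lf).
apply/(linear_boundedP g).
exists M; split; first exact: num_real.
by move=> N MN x; apply: (le_trans (hM x)); rewrite ler_wpM2r// ltW.
Qed.

Lemma bounded_operator_submod : submod_closed bounded_operator.
Proof.
split.
  apply/bounded_operatorP; split.
    by move=> a x y; rewrite scaler0 addr0.
  by exists 0 => x; rewrite normr0 mul0r.
move=> a f g /bounded_operatorP[lf [M hM]] /bounded_operatorP[lg [N hN]].
apply/bounded_operatorP; split.
  move=> b x y; rewrite /= !fctE lf lg !scalerDr !scalerA (mulrC a b).
  by rewrite addrACA.
exists (`|a| * M + N) => x; rewrite !fctE.
rewrite (le_trans (ler_normD _ _))// mulrDl lerD// normrZ -mulrA.
exact: ler_wpM2l.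
Qed.

HB.instance Definition _ :=
  GRing.isSubmodClosed.Build R (X -> X) bounded_operator bounded_operator_submod.

Record boundedOp := BoundedOp {
  bounded_fun :> X -> X;
  bounded_funP : bounded_fun \in bounded_operator
}.

HB.instance Definition _ := [isSub for bounded_fun].
HB.instance Definition _ := [Choice of boundedOp by <:].
HB.instance Definition _ := [SubChoice_isSubLmodule of boundedOp by <:].

Lemma bounded_opP (S T : boundedOp) : S =1 T -> S = T.
Proof. by move=> ST; apply: val_inj; apply/funext. Qed.

Definition op_le : rel boundedOp :=
  fun S T => `[< forall x : X, 0 <= x -> S x <= T x >].

Lemma op_le_refl : reflexive op_le.
Proof. by move=> S; apply/asboolP. Qed.

Lemma op_le_trans : transitive op_le.
Proof.
move=> S T U /asboolP TS /asboolP SU; apply/asboolP => x x0.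
exact: le_trans (TS x x0) (SU x x0).
Qed.

Lemma op_le_anti : antisymmetric op_le.
Proof.
move=> S T /andP[/asboolP ST /asboolP TS]; apply: bounded_opP => x.
have ST0 y : 0 <= y -> S y = T y.
  by move=> y0; apply/le_anti/andP; split; [exact: ST|exact: TS].
have /bounded_operatorP[lS _] := bounded_funP S.
have /bounded_operatorP[lT _] := bounded_funP T.
have -> : x = -1 *: (labs x - x) + labs x.
  by rewrite scaleN1r opprB subrK.
by rewrite lS lT !ST0 ?labs_ge0// leo_subr_ge0 ler_labs.
Qed.

HB.instance Definition _ := Order.Le_isPOrder.Build ring_display boundedOp
  op_le_refl op_le_anti op_le_trans.

Lemma op_leP (S T : boundedOp) :
  reflect (forall x : X, 0 <= x -> S x <= T x) (S <= T).
Proof. exact: asboolP. Qed.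

Lemma op_leD2l (U S T : boundedOp) : S <= T -> U + S <= U + T.
Proof. by move=> /op_leP ST; apply/op_leP => x x0; exact/leoD2l/ST. Qed.

Lemma op_scale_ge0 (a : R) (T : boundedOp) : 0 <= a -> 0 <= T -> 0 <= a *: T.
Proof.
by move=> a0 /op_leP T0; apply/op_leP => x x0; exact: scaleo_ge0 (T0 x x0).
Qed.

HB.instance Definition _ :=
  isOrderedLmodule.Build R boundedOp op_leD2l op_scale_ge0.

Lemma bounded_comp_subproof (S T : boundedOp) :
  (S : X -> X) \o T \in bounded_operator.
Proof.
have /bounded_operatorP[lS [M hM]] := bounded_funP S.
have /bounded_operatorP[lT [N hN]] := bounded_funP T.
apply/bounded_operatorP; split; first by move=> a x y /=; rewrite lT lS.
exists (`|M| * N) => x /=; rewrite (le_trans (hM _))// -mulrA.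
rewrite (@le_trans _ _ (`|M| * `|T x|))//; last exact: ler_wpM2l.
by rewrite ler_wpM2r// ler_norm.
Qed.

Definition bounded_comp (S T : boundedOp) : boundedOp :=
  BoundedOp (bounded_comp_subproof S T).

Lemma bounded_comp_ge0 (S T : boundedOp) :
  0 <= S -> 0 <= T -> 0 <= bounded_comp S T.
Proof.
by move=> /op_leP S0 /op_leP T0; apply/op_leP => x x0; exact: S0 _ (T0 _ x0).
Qed.

Lemma bounded_compDl (a : R) (S S' T : boundedOp) :
  bounded_comp (a *: S + S') T = a *: bounded_comp S T + bounded_comp S' T.
Proof. exact: bounded_opP. Qed.

Lemma bounded_compDr (a : R) (S T T' : boundedOp) :
  bounded_comp S (a *: T + T') = a *: bounded_comp S T + bounded_comp S T'.
Proof.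
have /bounded_operatorP[lS _] := bounded_funP S.
by apply: bounded_opP => x; exact: lS.
Qed.

End BoundedOperators.

Section RegularOperators.
Context (R : realType) (X : banachLattice R).

Definition regular_operator : {pred boundedOp X} :=
  mem (linear_span [set T : boundedOp X | 0 <= T]).

Lemma regular_operator_submod : submod_closed regular_operator.
Proof.
split; first by rewrite inE => W.
move=> a S T; rewrite !inE => rS rT W W0 WD WA.
exact: WD _ _ _ (rS W W0 WD WA) (rT W W0 WD WA).
Qed.

HB.instance Definition _ := GRing.isSubmodClosed.Build R (boundedOp X)
  regular_operator regular_operator_submod.

Record regularOp := RegularOp {
  regular_val :> boundedOp X;
  regular_valP : regular_val \in regular_operator
}.

HB.instance Definition _ := [isSub for regular_val].
HB.instance Definition _ := [Choice of regularOp by <:].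
HB.instance Definition _ := [SubChoice_isSubLmodule of regularOp by <:].
HB.instance Definition _ :=
  [SubChoice_isSubPOrder of regularOp by <: with ring_display].

Lemma regular_opP (S T : regularOp) : S =1 T -> S = T.
Proof. by move=> ST; apply: val_inj; exact: bounded_opP. Qed.

Lemma regular_leP (S T : regularOp) :
  reflect (forall x : X, 0 <= x -> S x <= T x) (S <= T).
Proof. exact: op_leP. Qed.

Lemma regular_leD2l (U S T : regularOp) : S <= T -> U + S <= U + T.
Proof. exact: op_leD2l. Qed.

Lemma regular_scale_ge0 (a : R) (T : regularOp) : 0 <= a -> 0 <= T -> 0 <= a *: T.
Proof. exact: op_scale_ge0. Qed.

HB.instance Definition _ :=
  isOrderedLmodule.Build R regularOp regular_leD2l regular_scale_ge0.

Lemma regular_ge0 (T : boundedOp X) : 0 <= T -> T \in regular_operator.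
Proof. by move=> T0; rewrite inE => W _ _; apply. Qed.

Lemma regular_comp_subproof (S T : regularOp) :
  bounded_comp S T \in regular_operator.
Proof.
have [rS rT] := (regular_valP S, regular_valP T); rewrite !inE in rS rT.
apply: (rS [set S | bounded_comp S T \in regular_operator]) => /=.
- rewrite (_ : bounded_comp _ _ = 0) ?(regular_operator_submod.1)//.
  exact: bounded_opP.
- move=> a u w hu hw; rewrite bounded_compDl.
  exact: regular_operator_submod.2.
move=> {rS}S /= S0.
apply: (rT [set T | bounded_comp S T \in regular_operator]) => /=.
- rewrite (_ : bounded_comp _ _ = 0) ?(regular_operator_submod.1)//.
  have := bounded_compDr 0 S 0 0; rewrite !scale0r !add0r.
  have := bounded_compDr (-1) S 0 0; rewrite scaler0 addr0 scaleN1r addNr.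
  by [].
- move=> a u w hu hw; rewrite bounded_compDr.
  exact: regular_operator_submod.2.
by move=> {rT}T /= T0; exact/regular_ge0/bounded_comp_ge0.
Qed.

Definition regular_comp (S T : regularOp) : regularOp :=
  RegularOp (regular_comp_subproof S T).

Lemma band_projection_bounded (P : X -> X) :
  band_projection P -> P \in @bounded_operator R X.
Proof.
move=> [lP _ P01]; apply/bounded_operatorP; split => //; exists 1 => x.
have P0 : P 0 = 0.
  by have := lP (-1) 0 0; rewrite scaler0 addr0 scaleN1r addNr.
have leP x1 x2 : x1 <= x2 -> P x1 <= P x2.
  rewrite -leo_subr_ge0 => /P01 /andP[+ _].
  by rewrite -scaleN1r addrC lP scaleN1r addrC leo_subr_ge0.
have PN y : P (- y) = - P y.
  by have := lP (-1) y 0; rewrite !addr0 P0 !addr0 !scaleN1r.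
rewrite mul1r; apply: ler_labs_norm; apply: labs_le.
  rewrite -(opprK (P x)) leoN2 -PN.
  apply: (le_trans (leP _ _ (lerN_labs x))).
  by have /P01 /andP[] := labs_ge0 x.
apply: (le_trans (leP _ _ (ler_labs x))).
by have /P01 /andP[] := labs_ge0 x.
Qed.

Lemma band_projection_regular (P : X -> X) (bP : band_projection P) :
  BoundedOp (band_projection_bounded bP) \in regular_operator.
Proof.
by apply/regular_ge0/op_leP => x x0; have [_ _ /(_ x x0) /andP[]] := bP.
Qed.

Definition band_op (P : X -> X) (bP : band_projection P) : regularOp :=
  RegularOp (band_projection_regular bP).

Section Blocks.
Context (I : Type) (P : I -> X -> X) (bP : forall i, band_projection (P i)).
Context (G : set (I * I)) (T : regularOp).

Definition blocks : set regularOp :=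
  [set regular_comp (band_op (bP ab.1)) (regular_comp T (band_op (bP ab.2)))
  | ab in G].

(* The default value 0 makes the supremum of the empty family 0, although
   the empty set has no supremum in a nonzero ordered vector space. *)
Definition block_sup : regularOp := supremum 0 blocks.

End Blocks.

End RegularOperators.

(* Main.v *)
Require Import Defs.
From mathcomp Require Import all_boot all_order all_algebra.
From mathcomp Require Import all_classical all_reals all_analysis.

Local Open Scope classical_set_scope.
Local Open Scope ring_scope.

(**
The blocks T |-> P_a T P_b are band projections on L_r(X), so it suffices that
the pointwise supremum of any nonempty set B of band projections on L_r(X) is
again one. Band projections F, G commute, and
  F x + G (x - F x) = F x \/ G x   (x >= 0)
defines a band projection, so B may be enlarged to an upward directed set
without changing pointwise suprema on the positive cone. A directed supremum
is additive, hence x |-> sup_F F x extends linearly from the cone. It exists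
because L_r(X) has suprema of bounded directed sets, which are computed
pointwise in X by the same extension argument. Finally F (Q x) = F x for F in B
and x >= 0, so that Q (Q x) = Q x.
*)

Set Implicit Arguments.
Unset Strict Implicit.
Unset Printing Implicit Defensive.

Import Order.TTheory GRing.Theory Num.Theory.

(** * Ordered modules and suprema of sets *)

(** Stands in for lattice operations, so that the same argument applies to [X] and to
    [regularOp X]. *)
Definition generating_cone (R : numDomainType) (V : orderedLmodType R) :=
  forall v : V, exists u w : V, [/\ 0 <= u, 0 <= w & v = u - w].

Section LinearPredicate.
Context (R : pzRingType) (V W : lmodType R) (f : V -> W).
Hypothesis lf : linear f.

Lemma linear_fun0 : f 0 = 0.
Proof. by have := lf (-1) 0 0; rewrite scaler0 addr0 scaleN1r addNr. Qed.

Lemma linear_funD x y : f (x + y) = f x + f y.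
Proof. by have := lf 1 x y; rewrite !scale1r. Qed.

Lemma linear_funZ a x : f (a *: x) = a *: f x.
Proof. by have := lf a x 0; rewrite linear_fun0 !addr0. Qed.

Lemma linear_funB x y : f (x - y) = f x - f y.
Proof. by rewrite linear_funD -scaleN1r linear_funZ scaleN1r. Qed.

End LinearPredicate.

Section OrderedModule.
Context (R : numDomainType) (V : orderedLmodType R).
Implicit Types x y z : V.

Lemma leo_subRL x y z : (x + y <= z) = (y <= z - x).
Proof. by rewrite -[LHS]leo_subr_ge0 -[RHS]leo_subr_ge0 opprD addrA. Qed.

Lemma leoD x y z t : x <= y -> z <= t -> x + z <= y + t.
Proof.
move=> xy zt; apply: (le_trans (leoD2l x _ _ zt)).
by rewrite ![_ + t]addrC; exact: leoD2l.
Qed.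

Lemma leoZ (a : R) x y : 0 <= a -> x <= y -> a *: x <= a *: y.
Proof.
move=> a0; rewrite -leo_subr_ge0 => /(scaleo_ge0 _ _ a0).
by rewrite scalerBr leo_subr_ge0.
Qed.

Lemma positive_le (W : orderedLmodType R) (f : V -> W) : linear f ->
  (forall x, 0 <= x -> 0 <= f x) -> forall x y, x <= y -> f x <= f y.
Proof.
move=> lf f0 x y; rewrite -leo_subr_ge0 => /f0.
by rewrite linear_funB// leo_subr_ge0.
Qed.

(** [C] and the sumset of [A] and [B] have the same upper bounds. Given such a bound, fix one
    summand and move it across the inequality. *)
Lemma supremumsD (A B C : set V) s t : supremums A s -> supremums B t ->
  (forall c, C c -> exists a b, [/\ A a, B b & c <= a + b]) ->
  (forall a b, A a -> B b -> exists2 c, C c & a + b <= c) ->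
  supremums C (s + t).
Proof.
move=> [ubs lubs] [ubt lubt] CAB ABC; split.
  move=> c /CAB[a [b [Aa Bb]]] /le_trans; apply.
  by apply: leoD; [exact: ubs|exact: ubt].
move=> u ubu; rewrite leo_subRL; apply: lubt => b Bb.
rewrite -leo_subRL addrC leo_subRL; apply: lubs => a Aa.
rewrite -leo_subRL addrC; have [c Cc /le_trans] := ABC _ _ Aa Bb.
by apply; exact: ubu.
Qed.

End OrderedModule.

Lemma supremumsZ (R : numFieldType) (V : orderedLmodType R) (A : set V) (a : R)
  (s : V) : 0 < a -> supremums A s -> supremums [set a *: x | x in A] (a *: s).
Proof.
move=> a0 [ubs lubs]; split.
  by move=> _ [x Ax <-]; apply: leoZ; [exact: ltW|exact: ubs].
move=> u ubu; have aN0 : a != 0 by rewrite gt_eqF.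
rewrite -(scale1r u) -(mulfV aN0) -scalerA.
apply: leoZ; first exact: ltW.
apply: lubs => x Ax; rewrite -(scale1r x) -(mulVf aN0) -scalerA.
by apply: leoZ; [rewrite invr_ge0 ltW|apply: ubu; exists x].
Qed.

(** * Linear extension from the positive cone *)

Section LinearExtension.
Context (R : realFieldType) (V : orderedLmodType R).
Hypothesis genV : generating_cone V.

Lemma linear_eq_cone (W : lmodType R) (f g : V -> W) : linear f -> linear g ->
  (forall x, 0 <= x -> f x = g x) -> f =1 g.
Proof.
move=> lf lg fg v; have [u [w [u0 w0 ->]]] := genV v.
by rewrite !linear_funB// !fg.
Qed.

(** Put [g (u - w) = f u - f w]; additivity of [f] on the cone makes this independent of the
    decomposition. *)
Lemma cone_linear_extension (W : lmodType R) (f : V -> W) :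
  (forall x y, 0 <= x -> 0 <= y -> f (x + y) = f x + f y) ->
  (forall a x, 0 <= a -> 0 <= x -> f (a *: x) = a *: f x) ->
  exists g, linear g /\ forall x, 0 <= x -> g x = f x.
Proof.
move=> fD fZ.
have diff u w u' w' : 0 <= u -> 0 <= w -> 0 <= u' -> 0 <= w' ->
    u - w = u' - w' -> f u - f w = f u' - f w'.
  move=> u0 w0 u'0 w'0 e; have : f (u + w') = f (u' + w).
    by congr f; rewrite -(subrK w u) e addrAC subrK.
  by rewrite !fD// => h; rewrite -(addrK (f w') (f u)) h addrAC addrK.
have ex v : exists y, forall u w, 0 <= u -> 0 <= w -> v = u - w -> y = f u - f w.
  have [u [w [u0 w0 vE]]] := genV v; exists (f u - f w) => u' w' u'0 w'0 vE'.
  by apply: diff => //; rewrite -vE.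
have [g gE] := choice ex; exists g; split; last first.
  move=> x x0; have f0 : f 0 = 0 by rewrite -[in LHS](scale0r 0) fZ// scale0r.
  by rewrite (gE x x 0)// ?f0 subr0.
move=> a x y; have [x1 [x2 [x10 x20 xE]]] := genV x.
have [y1 [y2 [y10 y20 yE]]] := genV y.
rewrite (gE x x1 x2)// (gE y y1 y2)//; have [a0|/ltW a0] := leP 0 a.
  rewrite (gE _ (a *: x1 + y1) (a *: x2 + y2))//; last 1 first.
  - by rewrite xE yE scalerBr opprD addrACA.
  - by rewrite !fD ?scaleo_ge0// !fZ// scalerBr opprD addrACA.
  - by rewrite leo_addr_ge0 ?scaleo_ge0.
  - by rewrite leo_addr_ge0 ?scaleo_ge0.
(* For [a <= 0] the two parts of [x] change places, which keeps all coefficients nonnegative. *)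
have na0 : 0 <= - a by rewrite oppr_ge0.
rewrite (gE _ (- a *: x2 + y1) (- a *: x1 + y2)).
- rewrite !fD ?scaleo_ge0// !fZ// opprD addrACA; congr (_ + _).
  by rewrite !scaleNr opprK addrC scalerBr.
- by rewrite leo_addr_ge0 ?scaleo_ge0.
- by rewrite leo_addr_ge0 ?scaleo_ge0.
rewrite xE yE opprD addrACA; congr (_ + _).
by rewrite !scaleNr opprK addrC scalerBr.
Qed.

(** Directedness gives additivity: for [x, y >= 0], a common majorant [H] of [F] and [G] satisfies
    [F x + G y <= H (x + y)]. *)
Lemma directed_sup_linear (W : orderedLmodType R) (D : set (V -> W)) :
  D !=set0 -> (forall F, D F -> linear F) ->
  (forall F G, D F -> D G -> exists2 H, D H &
     forall x, 0 <= x -> F x <= H x /\ G x <= H x) ->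
  (forall x, 0 <= x -> supremums [set F x | F in D] !=set0) ->
  exists S, linear S /\
    forall x, 0 <= x -> supremums [set F x | F in D] (S x).
Proof.
move=> [F0 DF0] linD dirD supD.
pose f x := xget 0 (supremums [set F x | F in D]).
have fP x : 0 <= x -> supremums [set F x | F in D] (f x).
  by move=> /supD[s sP]; rewrite /f; case: xgetP => [y _ //|/(_ s)].
have [||S [lS SE]] := @cone_linear_extension W f; last first.
- by exists S; split=> // x x0; rewrite SE//; exact: fP.
(* [supremumsZ] divides by [a], so [a = 0] is separate: there the set of values collapses to [{0}],
   as [D] is nonempty. *)
- move=> a x; rewrite le_eqVlt => /predU1P[<- _|a0 x0].
    rewrite !scale0r; apply: (is_subset1_supremums (fP 0 (lexx 0))).
    rewrite (_ : [set _ | _ in D] = [set 0]) ?supremums1//.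
    apply/seteqP; split=> [_ [F DF <-]|_ ->] /=; first exact/linear_fun0/linD.
    by exists F0 => //; exact/linear_fun0/linD.
  have ax0 : 0 <= a *: x by rewrite scaleo_ge0// ltW.
  apply: (is_subset1_supremums (fP _ ax0)).
  rewrite (_ : [set _ | _ in D] = [set a *: y | y in [set F x | F in D]]).
    exact/supremumsZ/fP.
  rewrite image_comp; apply: eq_imagel => F DF /=.
  exact/linear_funZ/linD.
- move=> x y x0 y0.
  apply: (is_subset1_supremums (fP _ (leo_addr_ge0 x0 y0))).
  apply: (supremumsD (fP x x0) (fP y y0)).
    move=> _ [F DF <-]; exists (F x), (F y).
    by split; [exists F|exists F|rewrite linear_funD//; exact: linD].
  move=> _ _ [F DF <-] [G DG <-]; have [H DH FGH] := dirD _ _ DF DG.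
  exists (H (x + y)); first by exists H.
  rewrite linear_funD; last exact: linD.
  by apply: leoD; [have [] := FGH x x0|have [] := FGH y y0].
Qed.

End LinearExtension.

(** * Band projections on an ordered module *)

Section BandProjections.
Context (R : realFieldType) (V : orderedLmodType R).
Implicit Types (P Q : V -> V) (x : V).

Lemma band_projection_le P x y : band_projection P -> x <= y -> P x <= P y.
Proof. by move=> [lP _ P01]; apply: positive_le => // z /P01 /andP[]. Qed.

Lemma band_projectionC P : band_projection P ->
  band_projection (fun x => x - P x).
Proof.
move=> [lP PP P01]; split.
- by move=> a x y; rewrite lP scalerBr opprD addrACA.
- by move=> x; rewrite (linear_funB lP) PP subrr subr0.
- move=> x x0; have /andP[Px0 Pxx] := P01 x x0; rewrite leo_subr_ge0 Pxx /=.
  by rewrite -leo_subr_ge0 opprB addrC subrK.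
Qed.

(** [Q] decreases both positive summands of [x = P x + (x - P x)] and fixes their sum, hence fixes
    each of them. *)
Lemma band_projection_invariant P Q x : band_projection P ->
  band_projection Q -> 0 <= x -> Q x = x -> Q (P x) = P x.
Proof.
move=> [lP PP P01] [lQ QQ Q01] x0 Qx; have /andP[Px0 Pxx] := P01 x x0.
have /andP[_ h1] := Q01 _ Px0; apply/le_anti; rewrite h1 /=.
have /Q01/andP[_] : 0 <= x - P x by rewrite leo_subr_ge0.
by rewrite (linear_funB lQ) Qx => /(leoD2l (- x) _ _); rewrite !addKr leoN2.
Qed.

Hypothesis genV : generating_cone V.

(** Split [x = Q x + (x - Q x)]. By invariance [P] keeps the first part in the range of [Q] and the
    second in the range of the complement, where [Q] vanishes; so [Q P x = Q P Q x = P Q x]. *)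
Lemma band_projection_comm P Q x : band_projection P -> band_projection Q ->
  P (Q x) = Q (P x).
Proof.
move=> bP bQ; have [[lP PP P01] [lQ QQ Q01]] := (bP, bQ).
apply: (linear_eq_cone genV (f := P \o Q) (g := Q \o P)) x.
- by move=> a x y /=; rewrite lQ lP.
- by move=> a x y /=; rewrite lP lQ.
move=> x x0 /=; have /andP[Qx0 Qxx] := Q01 x x0.
have h1 := band_projection_invariant bP bQ Qx0 (QQ x).
have z0 : 0 <= x - Q x by rewrite leo_subr_ge0.
have := band_projection_invariant bP (band_projectionC bQ) z0.
rewrite (linear_funB lQ) QQ subrr subr0 => /(_ erefl) /eqP.
rewrite -subr_eq0 addrAC subrr add0r oppr_eq0 (linear_funB lP) (linear_funB lQ).
by rewrite h1 subr_eq0 => /eqP.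
Qed.

(** The Boolean join [P + Q - Q P], written so that both summands are nonnegative on the cone. *)
Definition band_join P Q : V -> V := fun x => P x + Q (x - P x).

Lemma band_join_projection P Q : band_projection P -> band_projection Q ->
  band_projection (band_join P Q).
Proof.
move=> bP bQ; have [[lP PP P01] [lQ QQ Q01]] := (bP, bQ).
have lJ : linear (band_join P Q).
  move=> a x y; rewrite /band_join lP opprD addrACA -scalerBr lQ.
  by rewrite addrACA -scalerDr.
split => // [x|x x0].
  (* [x - J x = z - Q z] for the join [J]. [Q] kills this by idempotence and [P] by commutation,
     hence so does [J]. *)
  apply/esym/eqP; rewrite -subr_eq0 -(linear_funB lJ) /band_join opprD addrA.
  set z := x - P x.
  have Pz : P z = 0 by rewrite (linear_funB lP) PP subrr.
  have -> : P (z - Q z) = 0.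
    rewrite (linear_funB lP) Pz (band_projection_comm _ bP bQ) Pz.
    by rewrite (linear_fun0 lQ) subrr.
  by rewrite add0r subr0 (linear_funB lQ) QQ subrr.
have /andP[Px0 Pxx] := P01 x x0.
have /Q01/andP[Qz0 Qzz] : 0 <= x - P x by rewrite leo_subr_ge0.
by rewrite /band_join leo_addr_ge0//= leo_subRL.
Qed.

Lemma band_join_lub P Q x y : band_projection P -> band_projection Q ->
  0 <= x -> (band_join P Q x <= y) = (P x <= y) && (Q x <= y).
Proof.
move=> bP bQ x0; have [[lP PP P01] [lQ QQ Q01]] := (bP, bQ).
have /andP[Px0 Pxx] := P01 x x0.
have /Q01/andP[Qz0 Qzz] : 0 <= x - P x by rewrite leo_subr_ge0.
apply/idP/andP => [Jy|[Py Qy]].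
  split; apply: le_trans Jy; rewrite /band_join.
    by have := leoD2l (P x) _ _ Qz0; rewrite addr0.
  rewrite (linear_funB lQ) addrCA -[leLHS]addr0; apply: leoD2l.
  by rewrite leo_subr_ge0; have /andP[] := Q01 _ Px0.
(* [Q (x - P x) = Q (Q x - P x) <= Q (y - P x) <= y - P x]. *)
rewrite /band_join leo_subRL.
have /Q01/andP[_] : 0 <= y - P x by rewrite leo_subr_ge0.
apply: le_trans; rewrite !(linear_funB lQ) -(QQ x) ![_ - Q (P x)]addrC.
exact/leoD2l/(band_projection_le bQ).
Qed.

(** The closure of [B] under joins. Induction on membership shows that its members are band
    projections and obey the pointwise upper bounds of [B]. *)
Inductive band_joins (B : set (V -> V)) : set (V -> V) :=
| band_joins_gen P : B P -> band_joins B P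
| band_joins_join P Q : band_joins B P -> band_joins B Q ->
    band_joins B (band_join P Q).

(** Completeness is asked only for directed sets in an order interval [[0, y]], since in
    [regularOp X] their suprema can be computed pointwise. *)
Lemma band_projection_sup (B : set (V -> V)) : B !=set0 ->
  (forall P, B P -> band_projection P) ->
  (forall (D : set V) y, D !=set0 -> (forall x, D x -> 0 <= x <= y) ->
     (forall x x', D x -> D x' -> exists2 z, D z & x <= z /\ x' <= z) ->
     supremums D !=set0) ->
  exists Q, band_projection Q /\
    forall x, 0 <= x -> supremums [set P x | P in B] (Q x).
Proof.
move=> [P0 BP0] bB dcV.
have bD P : band_joins B P -> band_projection P.
  by elim=> [{}P /bB//|{}P Q _ bP _ bQ]; exact: band_join_projection.
have dirD P Q : band_joins B P -> band_joins B Q -> exists2 H, band_joins B H &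
    forall x, 0 <= x -> P x <= H x /\ Q x <= H x.
  move=> DP DQ; exists (band_join P Q); first exact: band_joins_join.
  move=> x x0; apply/andP.
  by rewrite -band_join_lub//; exact: bD.
(* Suprema depend only on the set of upper bounds, so the directed closure may replace [B]. *)
have ubD x : 0 <= x ->
    ubound [set P x | P in band_joins B] = ubound [set P x | P in B].
  move=> x0; apply/seteqP; split=> y yub _ [P BP <-].
    by apply: yub; exists P => //; exact: band_joins_gen.
  elim: BP => [{}P BP|{}P Q DP Py DQ Qy]; first by apply: yub; exists P.
  by rewrite band_join_lub ?Py//; exact: bD.
have D0 : band_joins B !=set0 by exists P0; exact: band_joins_gen.
have [|x x0|Q [lQ QP]] := directed_sup_linear genV D0 _ dirD.
- by move=> P /bD[].
- apply: (dcV _ x); first by exists (P0 x); exists P0 => //; exact: band_joins_gen.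
    by move=> _ [P /bD[_ _ P01] <-]; exact: P01.
  move=> _ _ [P DP <-] [P' DP' <-]; have [H DH PH] := dirD _ _ DP DP'.
  by exists (H x); [exists H|exact: PH].
have {}QP x : 0 <= x -> supremums [set P x | P in B] (Q x).
  by move=> x0; have := QP x x0; rewrite /supremums ubD.
have Q01 x : 0 <= x -> 0 <= Q x <= x.
  move=> x0; have [ubQ lubQ] := QP x x0; apply/andP; split.
    apply: (@le_trans _ _ (P0 x)); last by apply: ubQ; exists P0.
    by have [_ _ /(_ x x0) /andP[]] := bB _ BP0.
  by apply: lubQ => _ [P /bB[_ _ /(_ x x0) /andP[_ Px]] <-].
exists Q; split => //; split => //.
apply: (linear_eq_cone genV (f := Q \o Q) (g := Q)) => //.
  by move=> a x y /=; rewrite !lQ.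
move=> x x0 /=; have /andP[Qx0 Qxx] := Q01 x x0.
apply: (is_subset1_supremums (QP _ Qx0)).
(* [P x = P (P x) <= P (Q x) <= P x], so [Q x] and [x] have the same images under [B]. *)
rewrite (_ : [set _ | _ in B] = [set P x | P in B]); first exact: QP.
apply: eq_imagel => P BP; have bP := bB P BP; have [_ PP _] := bP.
apply/le_anti; rewrite (band_projection_le bP)//=.
rewrite -{1}(PP x) (band_projection_le bP)//.
by have [ubQ _] := QP x x0; apply: ubQ; exists P.
Qed.

End BandProjections.

(** * Regular operators on a Banach lattice *)

Section RegularOperatorsLattice.
Context (R : realType) (X : banachLattice R).

Lemma banach_lattice_generating : generating_cone X.
Proof.
move=> x; exists (labs x), (labs x - x); rewrite labs_ge0 leo_subr_ge0 ler_labs.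
by split=> //; rewrite opprB addrC subrK.
Qed.

(** [|S x| <= S |x| <= |T |x||] in the lattice, and the norm is monotone in the modulus; a bound for
    [T] thus serves for [S]. *)
Lemma dominated_bounded_operator (S : X -> X) (T : boundedOp X) : linear S ->
  (forall x, 0 <= x -> 0 <= S x <= T x) -> S \in @bounded_operator R X.
Proof.
move=> lS S0T; apply/bounded_operatorP; split => //.
have /bounded_operatorP[_ [M hM]] := Defs.bounded_funP T; exists M => x.
have S0 y : 0 <= y -> 0 <= S y by move=> /S0T/andP[].
have {S0T}STx : S (labs x) <= labs (T (labs x)).
  have /andP[_ STx] := S0T _ (labs_ge0 x).
  exact: le_trans STx (ler_labs _).
rewrite -(labs_norm x); apply: le_trans (hM _).
apply: ler_labs_norm; apply: labs_le.
  rewrite -leoN2 opprK -sub0r -(linear_fun0 lS) -(linear_funB lS) sub0r.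
  exact: le_trans (positive_le lS S0 (lerN_labs x)) STx.
exact: le_trans (positive_le lS S0 (ler_labs x)) STx.
Qed.

Lemma regular_op_generating : generating_cone (regularOp X).
Proof.
move=> T; have := regular_valP T; rewrite inE => rT.
have [A [B [A0 B0 TE]]] : exists A B : boundedOp X,
    [/\ 0 <= A, 0 <= B & regular_val T = A - B].
  (* The span is an intersection of submodules; it is tested on the differences of positive
     operators. *)
  apply: (rT [set T | exists A B : boundedOp X,
    [/\ 0 <= A, 0 <= B & T = A - B]]) => /=.
  - by exists 0, 0; rewrite subrr.
  - move=> a _ _ [A [B [A0 B0 ->]]] [C [D [C0 D0 ->]]].
    have [a0|/ltW a0] := leP 0 a.
      exists (a *: A + C), (a *: B + D); split.
      - by rewrite leo_addr_ge0 ?scaleo_ge0.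
      - by rewrite leo_addr_ge0 ?scaleo_ge0.
      - by rewrite scalerBr opprD addrACA.
    have na0 : 0 <= - a by rewrite oppr_ge0.
    exists (- a *: B + C), (- a *: A + D); split.
    - by rewrite leo_addr_ge0 ?scaleo_ge0.
    - by rewrite leo_addr_ge0 ?scaleo_ge0.
    - rewrite opprD addrACA; congr (_ + _).
      by rewrite !scaleNr opprK addrC scalerBr.
  - by move=> A A0; exists A, 0; rewrite subr0.
exists (RegularOp (regular_ge0 A0)), (RegularOp (regular_ge0 B0)).
by split => //; exact: val_inj.
Qed.

(** The pointwise supremum is linear and lies between [0] and [T], hence is bounded and positive, so
    regular. It is the least upper bound because operators are ordered pointwise on the cone. *)
Lemma regular_op_directed_sup (dcX : dedekind_complete X)
    (D : set (regularOp X)) (T : regularOp X) :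
  D !=set0 -> (forall S, D S -> 0 <= S <= T) ->
  (forall S S', D S -> D S' -> exists2 U, D U & S <= U /\ S' <= U) ->
  supremums D !=set0.
Proof.
move=> [S0 DS0] D0T dirD.
pose DX : set (X -> X) := [set (S : X -> X) | S in D].
have DX0 : DX !=set0 by exists S0; exists S0.
have D0Tx S x : D S -> 0 <= x -> 0 <= S x <= T x.
  by move=> /D0T/andP[/regular_leP S_ge0 /regular_leP ST] x0; rewrite S_ge0 ?ST.
have [|||S [lS SP]] := directed_sup_linear banach_lattice_generating DX0.
- by move=> _ [S DS <-]; have /bounded_operatorP[] := Defs.bounded_funP S.
- move=> _ _ [S DS <-] [S' DS' <-].
  have [U DU [/regular_leP SU /regular_leP S'U]] := dirD _ _ DS DS'.
  by exists U; [exists U|move=> x x0; split; [exact: SU|exact: S'U]].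
- move=> x x0; apply: dcX; split.
    by exists (S0 x); exists S0 => //; exists S0.
  by exists (T x) => _ [_ [S DS <-] <-]; have /andP[] := D0Tx S x DS x0.
have S0T x : 0 <= x -> 0 <= S x <= T x.
  move=> x0; have [ubS lubS] := SP x x0; apply/andP; split.
    have /andP[+ _] := D0Tx S0 x DS0 x0; move=> /le_trans; apply.
    by apply: ubS; exists S0 => //; exists S0.
  by apply: lubS => _ [_ [S' DS' <-] <-]; have /andP[] := D0Tx S' x DS' x0.
pose Sb := BoundedOp (dominated_bounded_operator lS S0T).
have Sb0 : 0 <= Sb by apply/op_leP => x /S0T /andP[].
exists (RegularOp (regular_ge0 Sb0)); split.
  move=> S' DS'; apply/regular_leP => x x0; have [ubS _] := SP x x0.
  by apply: ubS; exists S' => //; exists S'.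
move=> U ubU; apply/regular_leP => x x0; have [_ lubS] := SP x x0.
apply: lubS => _ [_ [S' DS' <-] <-].
by have /regular_leP := ubU _ DS'; apply.
Qed.

(** For [T, x >= 0], [P (T (Q x)) <= T (Q x) <= T x]. *)
Lemma block_band_projection (P Q : X -> X) (bP : band_projection P)
    (bQ : band_projection Q) :
  band_projection (fun T : regularOp X =>
    regular_comp (band_op bP) (regular_comp T (band_op bQ))).
Proof.
have [[lP PP P01] [lQ QQ Q01]] := (bP, bQ); split.
- by move=> a S T; apply: regular_opP => x; exact: lP.
- by move=> T; apply: regular_opP => x /=; rewrite PP QQ.
move=> T T0; have /regular_leP Tx0 := T0.
have /bounded_operatorP[lT _] := Defs.bounded_funP T.
apply/andP; split; apply/regular_leP => x x0 /=; have /andP[Qx0 Qxx] := Q01 x x0.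
  by have /andP[] := P01 _ (Tx0 _ Qx0).
have /andP[_ /le_trans] := P01 _ (Tx0 _ Qx0); apply.
exact: positive_le lT Tx0 _ _ Qxx.
Qed.

End RegularOperatorsLattice.

(** * Suprema of families of blocks *)

Theorem theorem2p1 (R : realType) (X : banachLattice R)
    (dcX : dedekind_complete X)
    (Lambda : Type) (P : Lambda -> X -> X)
    (bP : forall l, band_projection (P l))
    (dP : forall l m, l <> m -> forall x, P l (P m x) = 0)
    (Gamma : set (Lambda * Lambda)) :
  (forall T : regularOp X, 0 <= T ->
     (Gamma !=set0 ->
        supremums (blocks bP Gamma T) (block_sup bP Gamma T)) /\
     0 <= block_sup bP Gamma T) /\
  exists! Q : regularOp X -> regularOp X,
    band_projection Q /\
    forall T : regularOp X, 0 <= T -> Q T = block_sup bP Gamma T.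
Proof.
have [Q [bQ QE QP]] : exists Q : regularOp X -> regularOp X,
    [/\ band_projection Q,
      forall T, 0 <= T -> Q T = block_sup bP Gamma T &
      Gamma !=set0 -> forall T, 0 <= T -> supremums (blocks bP Gamma T) (Q T)].
  (* For empty [Gamma] the default value of [block_sup] makes [Q] the zero map. *)
  have [->|/set0P Gamma0] := eqVneq Gamma set0.
    exists (fun=> 0); split.
    - split=> [a x y|//|x x0]; first by rewrite scaler0 addr0.
      by rewrite lexx.
    - by move=> T _; rewrite /block_sup /blocks image_set0 supremum0.
    - by case.
  pose B : set (regularOp X -> regularOp X) := [set (fun T : regularOp X =>
    regular_comp (band_op (bP ab.1)) (regular_comp T (band_op (bP ab.2))))
    | ab in Gamma].
  have [|||Q [bQ QP]] :=
    band_projection_sup (@regular_op_generating R X) (B := B).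
  - by case: Gamma0 => ab Gab; eexists; exists ab.
  - by move=> _ [ab _ <-]; exact: block_band_projection.
  - exact: regular_op_directed_sup.
  have {}QP T : 0 <= T -> supremums (blocks bP Gamma T) (Q T).
    by move=> /QP; rewrite /B image_comp.
  (* On a nonempty set [supremum] chooses some supremum; uniqueness of suprema identifies it with
     [Q T]. *)
  exists Q; split => // T T0; rewrite /block_sup /supremum.
  have [ab Gab] := Gamma0; case: ifPn => [/eqP b0|_].
    suff : blocks bP Gamma T !=set0 by rewrite b0 => -[].
    by eexists; exists ab.
  case: xgetP => [U _ UP|/(_ (Q T))]; last by have := QP T T0.
  exact: is_subset1_supremums (QP T T0) UP.
have [lQ _ Q01] := bQ; split.
  move=> T T0; rewrite -QE//; split; first by move/QP; exact.
  by have /andP[] := Q01 _ T0.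
(* Uniqueness: linear maps that agree on a generating cone are equal. *)
exists Q; split=> // Q' [[lQ' _ _] Q'E]; apply/funext.
apply: (linear_eq_cone (@regular_op_generating R X)) => // T T0.
by rewrite QE// Q'E.
Qed.
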